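(* For all $k,n\ge 1$: (i) $\mathcal{PL}(\subseteq_k)_n\le\mathcal{PL}(\subseteq^{\top\bot}_k)_{n\cdot 2^k}$; (ii) if $k\ge 2$, then $\mathcal{PL}(\subseteq_k)_1\not\le\mathcal{PL}(\subseteq^{\top\bot}_k)_m$ for any $m<2^k$.
   Context: Let $\mathrm{Prop}$ be a countably infinite set of propositional symbols. Formulas of propositional logic $\mathcal{PL}$: $\phi::=p\mid\neg p\mid(\phi\wedge\phi)\mid(\phi\vee\phi)$ with $p\in\mathrm{Prop}$. $\mathrm{FV}(\phi)$ is the set of propositional symbols (free) in $\phi$. A team $T$ over a finite set of symbols $V=\mathrm{Var}(T)$ is a set of evaluations $s:V\to\{0,1\}$. For $\bar p=p_1\dots p_k$, $s(\bar p)=s(p_1)\dots s(p_k)$. Semantics: $T\models p$ iff $s(p)=1$ for all $s\in T$; $T\models\neg p$ iff $s(p)=0$ for all $s\in T$; $T\models\phi\wedge\psi$ iff $T\models\phi$ and $T\models\psi$; $T\models\phi\vee\psi$ iff there are $S,S'\subseteq T$ with $S\cup S'=T$, $S\models\phi$, $S'\models\psi$. Inclusion atom (arity $|\bar p|=|\bar q|$, sequences of propositional symbols): $T\models\bar p\subseteq\bar q$ iff for all $s\in T$ there is $s'\in T$ with $s(\bar p)=s'(\bar q)$. Primitive inclusion atom $\bar x\subseteq\bar p$ (arity $|\bar x|=|\bar p|$), where $\bar x$ is a sequence of constants from $\{\top,\bot\}$ and $\bar p$ a sequence of distinct propositional symbols: $T\models\bar x\subseteq\bar p$ iff $T=\emptyset$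 or there is $s'\in T$ with $s'(\bar p)=\bar x$ (identifying $\top$ with $1$ and $\bot$ with $0$). $\mathcal{PL}(\subseteq_k)_n$ (resp. $\mathcal{PL}(\subseteq^{\top\bot}_k)_n$) is the set of formulas of the extension of $\mathcal{PL}$ by (unnegated) inclusion atoms (resp. primitive inclusion atoms) that contain at most $n$ occurrences of such atoms, each of arity at most $k$. $\phi\equiv\psi$ means $\mathrm{FV}(\phi)=\mathrm{FV}(\psi)$ and $T\models\phi\iff T\models\psi$ for every team $T$ with $\mathrm{FV}(\phi)\subseteq\mathrm{Var}(T)$. $\mathcal L_1\le\mathcal L_2$ means every $\phi\in\mathcal L_1$ has some $\psi\in\mathcal L_2$ with $\phi\equiv\psi$. *)

(* Defs.v *)
From mathcomp Require Import all_boot finmap.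

Set Implicit Arguments.
Unset Strict Implicit.
Unset Printing Implicit Defensive.

Local Open Scope fset_scope.

(* A common syntax for both extensions of propositional logic.  [Incl ps qs] is
   the inclusion atom ps <= qs (repetitions allowed); [Prim xs ps _] is the
   primitive inclusion atom xs <= ps, with [true]/[false] for top/bottom and
   pairwise distinct symbols [ps]. *)
Inductive form (P : countType) : Type :=
| Pos of P
| Neg of P
| And of form P & form P
| Or of form P & form P
| Incl k of k.-tuple P & k.-tuple P
| Prim k (xs : k.-tuple bool) (ps : k.-tuple P) of uniq ps.

Section Syntax.
Variable P : countType.
Implicit Types phi psi : form P.

Fixpoint FV phi : {fset P} :=
  match phi with
  | Pos p | Neg p => [fset p]
  | And a b | Or a b => FV a `|` FV b
  | Incl _ ps qs => [fset p in (ps : seq P)] `|` [fset q in (qs : seq P)]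
  | Prim _ _ ps _ => [fset p in (ps : seq P)]
  end.

(* One entry per occurrence of an atom. *)
Fixpoint incl_arities phi : seq nat :=
  match phi with
  | Incl k _ _ => [:: k]
  | And a b | Or a b => incl_arities a ++ incl_arities b
  | _ => [::]
  end.

Fixpoint prim_arities phi : seq nat :=
  match phi with
  | Prim k _ _ _ => [:: k]
  | And a b | Or a b => prim_arities a ++ prim_arities b
  | _ => [::]
  end.

(* [PL_incl k n]: at most [n] inclusion atoms, each of arity at most [k], and no
   primitive ones; [PL_prim k n] exchanges the two kinds. *)
Definition PL_incl (k n : nat) phi : Prop :=
  [/\ prim_arities phi = [::], size (incl_arities phi) <= n
    & all (fun a => a <= k) (incl_arities phi)].

Definition PL_prim (k n : nat) phi : Prop :=
  [/\ incl_arities phi = [::], size (prim_arities phi) <= n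
    & all (fun a => a <= k) (prim_arities phi)].

End Syntax.

Section Semantics.
Variable P : countType.
Implicit Types (V : {fset P}) (phi psi : form P).

Definition evaluation V := {ffun V -> bool}.

Definition team V := {set evaluation V}.

(* The default value [false] outside [V] is never used in [equiv], which only
   considers teams whose domain contains all symbols of the formulas. *)
Definition value V (s : evaluation V) (p : P) : bool := oapp s false (insub p).

Fixpoint sat V (T : team V) phi : Prop :=
  match phi with
  | Pos p => forall s, s \in T -> value s p = true
  | Neg p => forall s, s \in T -> value s p = false
  | And a b => sat T a /\ sat T b
  | Or a b => exists S S' : team V, [/\ S :|: S' = T, sat S a & sat S' b]
  | Incl _ ps qs => forall s, s \in T ->
      exists2 s', s' \in T & map (value s) ps = map (value s') qs
  | Prim _ xs ps _ =>
      T = set0 \/ exists2 s', s' \in T & map (value s') ps = xs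
  end.

Definition equiv phi psi : Prop :=
  FV phi = FV psi /\
  forall V (T : team V), FV phi `<=` V -> (sat T phi <-> sat T psi).

Definition lang_le (L1 L2 : form P -> Prop) : Prop :=
  forall phi, L1 phi -> exists2 psi, L2 psi & equiv phi psi.

End Semantics.

(* Main.v *)
Require Import Defs.
From mathcomp Require Import all_boot finmap.

(** Upper bound: [ps <= qs] says that for every constant sequence [x] either no
    evaluation maps [ps] to [x] or some evaluation maps [qs] to [x]; as the empty
    team satisfies everything, the split disjunction of "[ps] differs from [x]"
    with the primitive atom [x <= qs] expresses exactly this.

    Lower bound: if a team [T] satisfies a formula with [m] primitive atoms, then
    choosing one witness per atom gives a set [W] of at most [m] evaluations such
    that every team between [W] and [T] satisfies the formula.  Apply this to the
    full team and [ps <= qs] with [2k] distinct symbols: adding to [W] an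
    evaluation with [ps = x] and [qs <> x] shows that [x] is a value of [qs] in
    [W], for each of the [2 ^ k] sequences [x]. *)

Set Implicit Arguments.
Unset Strict Implicit.
Unset Printing Implicit Defensive.

Local Open Scope fset_scope.

Lemma cat_eq_nil (T : Type) (s t : seq T) : s ++ t = [::] -> s = [::] /\ t = [::].
Proof. by case: s; case: t. Qed.

(** * From inclusion atoms to primitive inclusion atoms *)

Section Translation.
Variable P : countType.
Implicit Types (V : {fset P}) (phi psi chi : form P).
Implicit Types (ps qs : seq P) (x : seq bool) (f : seq bool -> form P).

Lemma sat_set0 V phi : sat (set0 : team V) phi.
Proof.
elim: phi => [p|p|a IHa b IHb|a IHa b IHb|j ps qs|j xs ps u] /=.
- by move=> s; rewrite inE.
- by move=> s; rewrite inE.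
- by [].
- by exists set0, set0; split=> //; rewrite setU0.
- by move=> s; rewrite inE.
- by left.
Qed.

Fixpoint differ_or ps x chi : form P :=
  match ps, x with
  | p :: ps', b :: x' => Or (if b then Neg p else Pos p) (differ_or ps' x' chi)
  | _, _ => chi
  end.

Lemma sat_literal_neq V (T : team V) p (b : bool) :
  sat T (if b then Neg p else Pos p) <-> forall s, s \in T -> value s p != b.
Proof.
by case: b; split=> H s /H /=; case: (value s p).
Qed.

(** [S] is the part of the split left to [chi]; an evaluation outside it goes to a literal at a
    position where [ps] and [x] disagree. *)
Lemma sat_differ_or V (T : team V) ps x chi : size x = size ps ->
  sat T (differ_or ps x chi) <->
  exists S : team V, [/\ S \subset T, sat S chi &
    forall s, s \in T -> s \notin S -> map (value s) ps != x].
Proof.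
elim: ps x T => [|p ps IH] [|b x] //= T.
  move=> _; split=> [H|[S [/subsetP sST H D]]].
    by exists T; split=> // s ->.
  suff -> : T = S by [].
  apply/setP=> s; apply/idP/idP=> [sT|/sST //].
  by apply: contraT => /(D _ sT).
case=> Ex; split.
  case=> S1 [S2 [<- /sat_literal_neq H1 /(IH _ _ Ex) [S [sS H D]]]].
  exists S; split=> //; first exact: subset_trans sS (subsetUr _ _).
  move=> s; rewrite inE eqseq_cons => /orP[/H1 /negbTE -> //|s2 sNS].
  by rewrite negb_and (D _ s2 sNS) orbT.
case=> S [/subsetP sST H D].
(* [S] stays whole on the right, since [chi] need not survive passing to subteams; the two parts may
   overlap. *)
exists [set s in T | value s p != b], (S :|: [set s in T | value s p == b]).
split.
- apply/setP=> s; rewrite !inE; case: (boolP (s \in S)) => [/sST ->|_].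
    by rewrite orbT.
  by case: (s \in T) => //=; case: eqP.
- by apply/sat_literal_neq=> s; rewrite inE => /andP[].
- apply/(IH _ _ Ex); exists S; split=> //; first exact: subsetUl.
  move=> s; rewrite !inE => /orP[-> //|/andP[sT /eqP sp] sNS].
  by have := D _ sT sNS; rewrite eqseq_cons sp eqxx.
Qed.

Lemma FV_differ_or ps x chi : size x = size ps ->
  FV (differ_or ps x chi) = [fset p in ps] `|` FV chi.
Proof.
elim: ps x => [|p ps IH] [|b x] //= => [_|[/IH ->]].
  by apply/fsetP=> q; rewrite !inE.
by apply/fsetP=> q; case: b; rewrite !inE /= orbA.
Qed.

Lemma prim_arities_differ_or ps x chi :
  prim_arities (differ_or ps x chi) = prim_arities chi.
Proof. by elim: ps x => [|p ps IH] [|[] x] //=. Qed.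

Lemma incl_arities_differ_or ps x chi :
  incl_arities (differ_or ps x chi) = incl_arities chi.
Proof. by elim: ps x => [|p ps IH] [|[] x] //=. Qed.

(** The values that [x] prescribes to the symbols of [qs], the first occurrence deciding at a
    repeated symbol. For equal lengths, mapping it over [qs] returns [x] exactly when [x] respects
    the repetitions. *)
Definition reading qs x (p : P) : bool := nth false x (index p qs).

(* A primitive atom needs distinct symbols, so repetitions in [qs] are dropped;
   if [x] gives two values to a repeated symbol, no evaluation maps [qs] to [x]
   and a contradiction is used instead. *)
Definition const_incl qs x : form P :=
  if (map (reading qs x) qs != x, ohead qs) is (true, Some q)
  then And (Pos q) (Neg q)
  else @Prim P _ (map_tuple (reading qs x) (in_tuple (undup qs)))
         (in_tuple (undup qs)) (undup_uniq qs).

Lemma sat_const_incl V (T : team V) qs x : size x = size qs ->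
  sat T (const_incl qs x) <->
  T = set0 \/ exists2 s, s \in T & map (value s) qs = x.
Proof.
move=> Ex; rewrite /const_incl.
have mapE (g : P -> bool) : map (reading qs x) qs = x ->
    map g (undup qs) = map (reading qs x) (undup qs) <-> map g qs = x.
  move=> Er; rewrite -[in X in _ <-> X]Er; split=> /eq_in_map H;
    by apply/eq_in_map=> q qin; apply: H; rewrite ?mem_undup in qin *.
case: eqP => [Er|NE] /=.
  by split=> -[->|[s sT /(mapE _ Er) H]]; [left|right; exists s|left|right; exists s].
(* If [qs] is empty, so is [x], and no conflict can arise. *)
case: qs Ex NE {mapE} => [|q qs] Ex NE /=; first by case: x Ex NE.
split=> [[Hp Hn]|[->|[s sT Es]]].
- left; apply/setP=> s; rewrite inE; apply/negP=> sT.
  by have := Hp s sT; rewrite Hn.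
- by split=> s; rewrite inE.
case: NE; rewrite -(Es : map (value s) (q :: qs) = x).
apply/eq_in_map=> r rin; by rewrite /reading (nth_map r) ?index_mem // nth_index.
Qed.

Lemma FV_const_incl_sub qs x : FV (const_incl qs x) `<=` [fset q in qs].
Proof.
rewrite /const_incl; apply/fsubsetP=> p.
case: eqP => _; first by rewrite /= !inE mem_undup.
by case: qs => [|q qs] /=; rewrite !inE ?orbb // => ->.
Qed.

(** A contradiction mentions only the head of [qs], whereas [equiv] asks for equal sets of symbols.
    The all-false sequence never conflicts with repetitions, so its conjunct contributes every
    symbol. *)
Lemma FV_const_incl_false qs :
  FV (const_incl qs (nseq (size qs) false)) = [fset q in qs].
Proof.
rewrite /const_incl; case: eqP => [_|[]] /=.
  by apply/fsetP=> p; rewrite !inE mem_undup.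
have E : reading qs (nseq (size qs) false) =1 fun=> false.
  by move=> p; rewrite /reading nth_nseq if_same.
by rewrite (eq_map E); elim: (qs) => //= q r ->.
Qed.

Lemma prim_arities_const_incl qs x k : size qs <= k ->
  size (prim_arities (const_incl qs x)) <= 1 /\
  all (fun a => a <= k) (prim_arities (const_incl qs x)).
Proof.
move=> le_k; rewrite /const_incl.
by case: eqP => _; case: qs le_k => [|q qs] //= le_k; split=> //;
  rewrite andbT (leq_trans _ le_k) // (size_undup (q :: qs)).
Qed.

Lemma incl_arities_const_incl qs x : incl_arities (const_incl qs x) = [::].
Proof. by rewrite /const_incl; case: eqP => _; case: qs. Qed.

(** A binary tree with one leaf per Boolean sequence of length [n]: no formula for the empty
    conjunction is required. *)
Fixpoint conj_all n f : form P :=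
  if n is n'.+1 then
    And (conj_all n' (fun x => f (true :: x))) (conj_all n' (fun x => f (false :: x)))
  else f [::].

Lemma sat_conj_all V (T : team V) n f :
  sat T (conj_all n f) <-> forall x, size x = n -> sat T (f x).
Proof.
elim: n f => [|n IH] f /=.
  by split=> [H x /size0nil ->|/(_ [::] erefl)].
split=> [[/IH Ht /IH Hf] [|[] x] //= [Ex]|H].
- exact: Ht.
- exact: Hf.
- by split; apply/IH=> x Ex; apply: H; rewrite /= Ex.
Qed.

Lemma FV_conj_all n f (A : {fset P}) :
  (forall x, size x = n -> FV (f x) `<=` A) -> FV (f (nseq n false)) = A ->
  FV (conj_all n f) = A.
Proof.
move=> sub eqA; apply/eqP; rewrite eqEfsubset; apply/andP; split.
  elim: n f sub {eqA} => [|n IH] f sub /=; first exact: sub.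
  by rewrite fsubUset !IH // => x Ex; apply: sub; rewrite /= Ex.
rewrite -{}eqA; elim: n f {sub} => [|n IH] f //=.
exact: fsubset_trans (IH (fun x => f (false :: x))) (fsubsetUr _ _).
Qed.

Lemma prim_arities_conj_all n k f :
  (forall x, size (prim_arities (f x)) <= 1 /\
             all (fun a => a <= k) (prim_arities (f x))) ->
  size (prim_arities (conj_all n f)) <= 2 ^ n /\
  all (fun a => a <= k) (prim_arities (conj_all n f)).
Proof.
elim: n f => [|n IH] f H /=; first exact: H.
have [//|st at_] := IH (fun x => f (true :: x)).
have [//|sf af] := IH (fun x => f (false :: x)).
by rewrite size_cat all_cat at_ af expnS mul2n -addnn leq_add.
Qed.

Lemma incl_arities_conj_all n f :
  (forall x, incl_arities (f x) = [::]) -> incl_arities (conj_all n f) = [::].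
Proof. by elim: n f => [|n IH] f H //=; rewrite !IH. Qed.

Fixpoint incl_to_prim phi : form P :=
  match phi with
  | And a b => And (incl_to_prim a) (incl_to_prim b)
  | Or a b => Or (incl_to_prim a) (incl_to_prim b)
  | Incl j ps qs => conj_all j (fun x => differ_or ps x (const_incl qs x))
  | _ => phi
  end.

Lemma sat_incl_to_prim V (T : team V) phi :
  sat T phi <-> sat T (incl_to_prim phi).
Proof.
elim: phi T => [p|p|a IHa b IHb|a IHa b IHb|j ps qs|j xs ps u] T //=.
- by rewrite IHa IHb.
- by split=> -[S [S' [E /IHa Ha /IHb Hb]]]; exists S, S'.
rewrite sat_conj_all; split=> [H x Ex|H s sT].
  apply/sat_differ_or; first by rewrite Ex size_tuple.
  have [s0 /andP[s0T /eqP E0]|none] :=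
      pickP (fun s : evaluation V => (s \in T) && (map (value s) ps == x)).
    exists T; split=> // [|s ->] //.
    apply/sat_const_incl; first by rewrite Ex size_tuple.
    by right; have [s' s'T E] := H _ s0T; exists s'; rewrite // -E.
  (* No evaluation in [T] maps [ps] to [x], so the literals cover [T] and the atom gets the empty
     team. *)
  exists set0; split; [exact: sub0set | exact: sat_set0 | move=> s sT _].
  by have := none s; rewrite /= sT => /= ->.
(* For [x] the value of [ps] at [s], no literal can take [s]; hence [s] is in [S], which is
   nonempty. *)
have Ex : size (map (value s) ps) = j by rewrite size_map size_tuple.
have /sat_differ_or := H _ Ex; rewrite Ex size_tuple => /(_ erefl).
case=> S [/subsetP sST HS D].
have sS : s \in S by apply: contraT => /(D _ sT); rewrite eqxx.
move: HS => /sat_const_incl; rewrite Ex size_tuple => /(_ erefl).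
case=> [S0|[s' s'S E]]; first by rewrite S0 inE in sS.
by exists s'; [exact: sST | rewrite E].
Qed.

Lemma FV_incl_to_prim phi : FV (incl_to_prim phi) = FV phi.
Proof.
elim: phi => [p|p|a IHa b IHb|a IHa b IHb|j ps qs|j xs ps u] //=;
  try by rewrite IHa IHb.
apply: FV_conj_all => [x Ex|].
  by rewrite FV_differ_or ?size_tuple // fsetUS // FV_const_incl_sub.
rewrite FV_differ_or ?size_tuple ?size_nseq //.
by rewrite -[X in nseq X](size_tuple qs) FV_const_incl_false.
Qed.

Lemma PL_prim_incl_to_prim k n phi :
  PL_incl k n phi -> PL_prim k (n * 2 ^ k) (incl_to_prim phi).
Proof.
case=> prim0 size_n arity_k.
(* Counting against the actual number of inclusion atoms instead of [n] lets the bounds add up over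
   connectives. *)
rewrite /PL_prim; suff [-> size_le ->] : [/\ incl_arities (incl_to_prim phi) = [::],
    size (prim_arities (incl_to_prim phi)) <= size (incl_arities phi) * 2 ^ k
  & all (fun a => a <= k) (prim_arities (incl_to_prim phi))].
  by split=> //; rewrite (leq_trans size_le) // leq_mul2r size_n orbT.
elim: phi prim0 arity_k {size_n} => [p|p|a IHa b IHb|a IHa b IHb|j ps qs|] //=.
1,2: move=> /cat_eq_nil [pa pb]; rewrite all_cat.
1,2: move=> /andP[/(IHa pa) [-> sa aa] /(IHb pb) [-> sb ab]].
1,2: by rewrite all_cat aa ab !size_cat mulnDl leq_add.
rewrite andbT mul1n => _ jk; split.
- by apply: incl_arities_conj_all => x;
    rewrite incl_arities_differ_or incl_arities_const_incl.
all: have [x|sz al] := @prim_arities_conj_all j k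
  (fun x => differ_or ps x (const_incl qs x)).
all: rewrite ?prim_arities_differ_or.
all: try by apply: prim_arities_const_incl; rewrite size_tuple.
- by rewrite (leq_trans sz) // leq_exp2l.
- by [].
Qed.

End Translation.

(** * Lower bound on the number of primitive atoms *)

Section LowerBound.
Variable P : countType.

(** Literals pass to subteams and need no witness, a primitive atom needs at most one, and
    connectives unite the witness sets. *)
Lemma prim_witnesses V (T : team V) (psi : form P) :
  incl_arities psi = [::] -> sat T psi ->
  exists W : team V, [/\ W \subset T, #|W| <= size (prim_arities psi) &
    forall T' : team V, W \subset T' -> T' \subset T -> sat T' psi].
Proof.
elim: psi T => [p|p|a IHa b IHb|a IHa b IHb|j ps qs|j xs ps u] T //=.
- move=> _ H; exists set0; rewrite sub0set cards0.
  by split=> // T' _ /subsetP sT s /sT /H.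
- move=> _ H; exists set0; rewrite sub0set cards0.
  by split=> // T' _ /subsetP sT s /sT /H.
- move=> /cat_eq_nil [/IHa {}IHa /IHb {}IHb] [/IHa [A [sA cA HA]] /IHb [B [sB cB HB]]].
  exists (A :|: B); split=> [||T']; first by rewrite subUset sA.
    by rewrite size_cat (leq_trans (leq_card_setU _ _)) // leq_add.
  by rewrite subUset => /andP[AT BT] sT; split; [exact: HA | exact: HB].
- move=> /cat_eq_nil [/IHa {}IHa /IHb {}IHb] [S [S' [<- /IHa [A [sA cA HA]]]]].
  move=> /IHb [B [sB cB HB]].
  exists (A :|: B); split=> [||T']; first exact: setUSS.
    by rewrite size_cat (leq_trans (leq_card_setU _ _)) // leq_add.
  (* Cut along the given split, each part of [T'] stays between the witnesses of its disjunct and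
     its half of the team. *)
  rewrite subUset => /andP[AT BT] sT; exists (T' :&: S), (T' :&: S'); split.
  + by rewrite -setIUr; apply/setIidPl.
  + by apply: HA; rewrite ?subsetIr // subsetI AT.
  + by apply: HB; rewrite ?subsetIr // subsetI BT.
- move=> _ [->|[s sT Es]].
    exists set0; rewrite sub0set cards0; split=> // T' _.
    by rewrite subset0 => /eqP ->; left.
  exists [set s]; rewrite sub1set cards1; split=> // T'.
  by rewrite sub1set => sT' _; right; exists s.
Qed.

Lemma infinite_uniq_seq : (forall r : seq P, exists p : P, p \notin r) ->
  forall n, exists2 r : seq P, size r = n & uniq r.
Proof.
move=> P_infinite; elim=> [|n [r <- ur]]; first by exists [::].
by have [p pr] := P_infinite r; exists (p :: r); rewrite //= pr.
Qed.

Lemma evaluation_of_values V (rs : seq P) (y : seq bool) :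
  uniq rs -> {subset rs <= V} -> size y = size rs ->
  exists s : evaluation V, map (value s) rs = y.
Proof.
(* The default [false] only fills in symbols of [V] outside [rs]. *)
move=> urs rsV Ey; exists [ffun v : V => nth false y (index (val v) rs)].
transitivity (map (fun r => nth false y (index r rs)) rs).
  apply/eq_in_map=> r rin; rewrite /value.
  by case: insubP => [v _ Ev|]; [rewrite /= ffunE Ev | rewrite rsV].
apply: (@eq_from_nth _ false) => [|i]; rewrite size_map ?Ey // => i_lt.
case: rs urs i_lt {rsV Ey} => // r rs urs i_lt.
by rewrite (nth_map r) // index_uniq.
Qed.

Lemma incl_atom_prim_lower_bound k (ps qs : k.-tuple P) (psi : form P) :
  0 < k -> uniq (ps ++ qs) -> incl_arities psi = [::] ->
  Defs.equiv (Incl ps qs) psi -> 2 ^ k <= size (prim_arities psi).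
Proof.
move=> k_gt0 urs incl0 [_ eqv].
set V := FV (Incl ps qs) in eqv.
have rsV : {subset (ps ++ qs : seq P) <= V}.
  by move=> p; rewrite mem_cat !inE.
have eval (x y : k.-tuple bool) : exists s : evaluation V,
    map (value s) ps = x /\ map (value s) qs = y.
  have [|s] := evaluation_of_values (y := x ++ y) urs rsV.
    by rewrite !size_cat !size_tuple.
  rewrite map_cat => /eqP; rewrite eqseq_cat ?size_map ?size_tuple //.
  by case/andP=> /eqP ? /eqP ?; exists s.
have satT : sat ([set: evaluation V] : team V) psi.
  apply/eqv; first exact: fsubset_refl.
  move=> s _; have [s' [_ E]] := eval (map_tuple (value s) ps) (map_tuple (value s) ps).
  by exists s'; rewrite ?inE.
have [W [_ cW HW]] := prim_witnesses incl0 satT.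
apply: leq_trans cW.
suff im : [set: k.-tuple bool] \subset [set map_tuple (value s) qs | s : evaluation V in W].
  have := leq_trans (subset_leq_card im) (leq_imset_card _ _).
  by rewrite cardsT card_tuple card_bool.
apply/subsetP=> x _.
(* As [0 < k], [x] differs from its negation, so [s] is not its own witness: the witness lies in [W]
   and has value [x] on [qs]. *)
have [s [Ep Eq]] := eval x (map_tuple negb x).
have /eqv : sat (s |: W) psi by apply: HW; rewrite ?subsetUr ?subsetT.
move=> /(_ (fsubset_refl _)) /= /(_ s (setU11 _ _)) [s' s'in].
rewrite {}Ep => Ex; apply/imsetP; exists s'; last exact/val_inj.
move: s'in; rewrite !inE => /orP[/eqP E|//].
move: Ex; rewrite E Eq /=; case: x {Eq} => -[|b x] //=.
  by move=> /eqP sz; rewrite -sz in k_gt0.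
by move=> _ []; case: b.
Qed.

End LowerBound.

Theorem theorem5p3 (P : countType)
  (P_infinite : forall r : seq P, exists p : P, p \notin r)
  (k n : nat) (k_ge1 : 1 <= k) (n_ge1 : 1 <= n) :
  lang_le (@PL_incl P k n) (@PL_prim P k (n * 2 ^ k)) /\
  (2 <= k -> forall m : nat, m < 2 ^ k ->
     ~ lang_le (@PL_incl P k 1) (@PL_prim P k m)).
Proof.
split=> [phi phiL|_ m m_lt le].
  exists (incl_to_prim phi); first exact: PL_prim_incl_to_prim.
  by split=> [|V T _]; [rewrite FV_incl_to_prim | exact: sat_incl_to_prim].
(* The two halves of [rs] become the two sides of the atom. *)
have [rs Ers urs] := infinite_uniq_seq P_infinite (k + k).
have size_ps : size (take k rs) == k by rewrite size_takel // Ers leq_addr.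
have size_qs : size (drop k rs) == k by rewrite size_drop Ers addnK.
have [|psi [incl0 size_m _] eqv] := le (Incl (Tuple size_ps) (Tuple size_qs)).
  by split=> //=; rewrite leqnn.
have := incl_atom_prim_lower_bound k_ge1 _ incl0 eqv.
rewrite /= cat_take_drop => /(_ urs) bound.
by have := leq_ltn_trans (leq_trans bound size_m) m_lt; rewrite ltnn.
Qed.
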